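(* Let $\mathcal S$ be a set of solutions $(x,y,k)$ of $y^2=x^3+k$ (in integers $x\ge 1$, $y\ge 1$, $k\ne 0$). The following statements are equivalent. (i) For every $\delta\in(0,1/2)$, only finitely many solutions in $\mathcal S$ satisfy $|k|<x^{1/2-\delta}$. (ii) For every $\varepsilon>0$, only finitely many solutions in $\mathcal S$ satisfy $G_a>1+\varepsilon$. In particular, the weak Hall conjecture holds if and only if (ii) holds for $\mathcal S$ equal to the set of all solutions.
   Context: A solution is a triple $(x,y,k)$ of integers with $y^2=x^3+k$, $x\ge 1$, $y\ge 1$ and $k\ne 0$. For a solution put $M=\max\{x^3,y^2\}$ and $P=xy|k|$ (one always has $P\ge 2$). The approximation gain of the solution is $G_a=\frac{\log M}{\log P}$. The weak Hall conjecture is the statement: for every $\delta>0$, there are only finitely many solutions $(x,y,k)$ of $y^2=x^3+k$ with $x,y\ge 1$ and $0<|k|<x^{1/2-\delta}$. *)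

(* Defs.v *)
From HB Require Import structures.
From mathcomp Require Import all_boot all_order all_algebra.
From mathcomp Require Import all_classical all_reals all_analysis.

Set Implicit Arguments.
Unset Strict Implicit.
Unset Printing Implicit Defensive.

Import Order.TTheory GRing.Theory Num.Theory.

Local Open Scope classical_set_scope.
Local Open Scope ring_scope.

(* A triple ((x, y), k) of integers. *)
Definition triple := (int * int * int)%type.

Definition tx (s : triple) : int := s.1.1.
Definition ty (s : triple) : int := s.1.2.
Definition tk (s : triple) : int := s.2.

Definition solutions : set triple :=
  [set s | [/\ ty s ^+ 2 = tx s ^+ 3 + tk s,
               1 <= tx s, 1 <= ty s & tk s != 0]].

Definition solM (s : triple) : int := Num.max (tx s ^+ 3) (ty s ^+ 2).

Definition solP (s : triple) : int := tx s * ty s * `|tk s|.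

(* On solutions solP is at least 2, so the denominator is positive. *)
Definition approx_gain (R : realType) (s : triple) : R :=
  ln (solM s)%:~R / ln (solP s)%:~R.

Definition weak_Hall (R : realType) : Prop :=
  forall delta : R, 0 < delta ->
    finite_set [set s : triple |
      [/\ ty s ^+ 2 = tx s ^+ 3 + tk s, 1 <= tx s, 1 <= ty s,
          0 < `|tk s| & `|tk s|%:~R < (tx s)%:~R `^ (1 / 2 - delta)]].

Definition Hall_finite (R : realType) (S : set triple) : Prop :=
  forall delta : R, 0 < delta < 1 / 2 ->
    finite_set [set s | S s /\ `|tk s|%:~R < (tx s)%:~R `^ (1 / 2 - delta)].

Definition gain_finite (R : realType) (S : set triple) : Prop :=
  forall eps : R, 0 < eps ->
    finite_set [set s | S s /\ approx_gain R s > 1 + eps].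

(* Main.v *)
(* A gain above 1 forces x^3 and y^2 to agree up to a factor 2, and so does
   |k| < x^(1/2).  For such solutions, up to bounded errors,
   log M = 3 log x and log P = 5/2 log x + log |k|, so both conditions bound
   log |k| by (1/2 - c) log x + O(1) for some c > 0.  The O(1) is absorbed by a
   smaller c once x is large, and only finitely many such solutions have
   bounded x. *)
Require Import Defs.
From HB Require Import structures.
From mathcomp Require Import all_boot all_order all_algebra.
From mathcomp Require Import all_classical all_reals all_analysis.
From mathcomp Require Import zify lra.

Set Implicit Arguments.
Unset Strict Implicit.
Unset Printing Implicit Defensive.

Import Order.TTheory GRing.Theory Num.Theory.

Local Open Scope classical_set_scope.
Local Open Scope ring_scope.

(* Here k is the difference of x^3 and y^2, so 2|k| exceeds the larger one, while xy >= 2. *)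
Lemma unbalanced_lt (x y k : int) :
  y ^+ 2 = x ^+ 3 + k -> 1 <= x -> 1 <= y ->
  2 * x ^+ 3 < y ^+ 2 \/ 2 * y ^+ 2 < x ^+ 3 ->
  Num.max (x ^+ 3) (y ^+ 2) < x * y * `|k|.
Proof.
move=> E x1 y1 unbal.
have xy2 : 2 <= x * y.
  have [xE|x_gt1] : x = 1 \/ 2 <= x by lia.
    have [yE|y_gt1] : y = 1 \/ 2 <= y by lia.
      by move: unbal; rewrite xE yE !expr1n; lia.
    by nia.
  by nia.
have x3_gt0 : 0 < x ^+ 3 by apply: exprn_gt0; lia.
have y2_gt0 : 0 < y ^+ 2 by apply: exprn_gt0; lia.
move: (x ^+ 3) (y ^+ 2) (x * y) E unbal xy2 x3_gt0 y2_gt0 => u v c *.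
have : 2 * `|k| <= c * `|k| by rewrite ler_wpM2r.
lia.
Qed.

Lemma gain_gt1_balanced (s : triple) : solutions s -> Defs.solP s < solM s ->
  ty s ^+ 2 <= 2 * tx s ^+ 3 /\ tx s ^+ 3 <= 2 * ty s ^+ 2.
Proof.
case=> E x1 y1 _ PM; split; rewrite leNgt; apply/negP => lt.
- have := unbalanced_lt E x1 y1 (or_introl lt).
  by rewrite -/(solM s) -/(Defs.solP s); lia.
- have := unbalanced_lt E x1 y1 (or_intror lt).
  by rewrite -/(solM s) -/(Defs.solP s); lia.
Qed.

(** The product could only be 1 with [x = y = 1], and then [k = 0]. *)
Lemma solP_gt1 (s : triple) : solutions s -> 1 < Defs.solP s.
Proof.
rewrite /Defs.solP => -[E x1 y1 k0].
have k1 : 1 <= `|tk s| by lia.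
have xy1 : 1 <= tx s * ty s by nia.
have [->|k2] : `|tk s| = 1 \/ 2 <= `|tk s| by lia.
  have [xE|x2] : tx s = 1 \/ 2 <= tx s by lia.
    have [yE|y2] : ty s = 1 \/ 2 <= ty s by lia.
      by move: E; rewrite xE yE !expr1n; lia.
    by nia.
  by nia.
by nia.
Qed.

Section Logarithms.
Variable R : realType.
Implicit Types (s : triple) (S : set triple).

Let lnz (n : int) : R := ln n%:~R.

Let pos_intr (n : int) : 1 <= n -> (n%:~R : R) \is Num.pos.
Proof. by move=> n1; rewrite posrE ltr0z; lia. Qed.

Lemma ler_lnz (m n : int) : 1 <= m -> m <= n -> lnz m <= lnz n.
Proof.
move=> m1 mn; rewrite /lnz ler_ln ?ler_int ?pos_intr//.
exact: le_trans mn.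
Qed.

Lemma lnzM (m n : int) : 1 <= m -> 1 <= n -> lnz (m * n) = lnz m + lnz n.
Proof. by move=> m1 n1; rewrite /lnz intrM lnM ?pos_intr. Qed.

Lemma lnzX (n : int) i : 1 <= n -> lnz (n ^+ i) = i%:R * lnz n.
Proof.
move=> n1; rewrite /lnz rmorphXn/= lnXn ?mulr_natl//.
by rewrite ltr0z; lia.
Qed.

Lemma lnz_ge0 (n : int) : 1 <= n -> 0 <= lnz n.
Proof. by move=> n1; apply: ln_ge0; rewrite ler1z. Qed.

Lemma ln_solP s : solutions s ->
  lnz (Defs.solP s) = lnz (tx s) + lnz (ty s) + lnz `|tk s|.
Proof. by case=> _ x1 y1 k0; rewrite /Defs.solP !lnzM//; nia. Qed.

Lemma gain_gtE s (eps : R) : solutions s ->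
  (1 + eps < approx_gain R s) = ((1 + eps) * lnz (Defs.solP s) < lnz (solM s)).
Proof.
by move=> sol; rewrite ltr_pdivlMr// ln_gt0// ltr1z solP_gt1.
Qed.

Lemma lt_powR_lnE (m n : int) (a : R) : 1 <= m -> 1 <= n ->
  (m%:~R < n%:~R `^ a) = (lnz m < a * lnz n).
Proof.
move=> m1 n1; have := pos_intr n1; rewrite posrE => n0.
by rewrite /lnz -ln_powR ltr_ln ?pos_intr// posrE powR_gt0.
Qed.

(** These are the exceptions left over when the O(1) is absorbed for large [x]. The bound on [lnz x]
    bounds [x], then [y ^+ 2 <= 2 * x ^+ 3] bounds [y], and [k] is determined by [x] and [y]. *)
Lemma finite_small_solutions (C : R) : finite_set
  [set s | [/\ solutions s, ty s ^+ 2 <= 2 * tx s ^+ 3 & lnz (tx s) < C]].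
Proof.
pose N := (Num.trunc (expR C)).+1.
pose f (p : nat * nat) : triple :=
  ((p.1%:Z, p.2%:Z), p.2%:Z ^+ 2 - p.1%:Z ^+ 3).
apply: (@sub_finite_set _ _ (f @` (`I_N `*` `I_(2 * N ^ 3)))); last first.
  by apply: finite_image; apply: finite_setX; exact: finite_II.
move=> [[x y] k]; rewrite /solutions /tx /ty /tk /= => -[[E x1 y1 _] yx xC].
have xN : (`|x| < N)%N.
  have : (x%:~R : R) < N%:~R.
    apply: lt_trans (truncnS_gt _).
    by rewrite -(lnK (pos_intr x1)) ltr_expR.
  by rewrite ltr_int; lia.
exists (`|x|%N, `|y|%N).
  split=> //=.
  have x3N : x ^+ 3 < (N%:Z) ^+ 3 by rewrite ltrXn2r//; lia.
  have yy : y <= y ^+ 2 by rewrite expr2; nia.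
  rewrite -ltz_nat PoszM -[Posz (N ^ 3)]natz natrX natz.
  lia.
by rewrite /f /= !gez0_abs ?E; [congr (_, _, _); lia|lia|lia].
Qed.

Lemma Hall_finite_gain S : S `<=` solutions ->
  Hall_finite R S -> gain_finite R S.
Proof.
move=> Ssol H eps eps0.
(* The minimum with 1/4 only keeps delta below 1/2. *)
pose delta : R := Num.min eps (1 / 4).
have d0 : 0 < delta by rewrite lt_min eps0/=; lra.
have de : delta <= eps by rewrite ge_min lexx.
have d4 : delta <= 1 / 4 by rewrite ge_min lexx orbT.
have d12 : 0 < delta < 1 / 2 by apply/andP; split; lra.
pose L := lnz 2.
(* The error to absorb is [L] from [log M] plus [(1 + eps) * L / 2] from [log y]; from [log x = C]
   on, [3 / 2 * eps * log x] outweighs it. *)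
pose C := L * (3 / 2 + eps / 2) / (3 / 2 * eps).
have := conj (H _ d12) (finite_small_solutions C).
rewrite -finite_setU; apply: sub_finite_set => s [Ss].
have sol := Ssol _ Ss; have [E x1 y1 k0] := sol.
have k1 : 1 <= `|tk s| by lia.
rewrite gain_gtE// => gain.
have lnP0 : 0 < lnz (Defs.solP s) by rewrite ln_gt0// ltr1z solP_gt1.
(* Otherwise [log M <= log P < (1 + eps) * log P], against the gain. *)
have PM : Defs.solP s < solM s.
  rewrite ltNge; apply/negP => /ler_lnz MP.
  have : lnz (solM s) <= lnz (Defs.solP s).
    by apply: MP; rewrite /solM le_max exprn_ege1.
  by nra.
have [yx xy] := gain_gt1_balanced sol PM.
have [xC|Cx] := ltP (lnz (tx s)) C; [by right|left; split=> //].
rewrite lt_powR_lnE//.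
have L0 : 0 <= L by exact: lnz_ge0.
have x3 : 1 <= tx s ^+ 3 by exact: exprn_ege1.
have y2 : 1 <= ty s ^+ 2 by exact: exprn_ege1.
have lnM : lnz (solM s) <= L + 3 * lnz (tx s).
  rewrite -(lnzX 3)// -lnzM//; apply: ler_lnz; rewrite /solM; lia.
have lny : 3 * lnz (tx s) <= L + 2 * lnz (ty s).
  by rewrite -(lnzX 3)// -(lnzX 2)// -lnzM//; apply: ler_lnz.
have K0 := lnz_ge0 k1.
move: gain Cx; rewrite ln_solP// /C ler_pdivrMr; last lra.
move: (lnz (tx s)) (lnz (ty s)) (lnz `|tk s|) (lnz (solM s)) (lnz_ge0 x1)
  lnM lny K0 => X Y K M X0 MX XY K0 gain CX.
(* Bounding [(1 + eps) * K] below by [K] turns this into [K < (1 / 2 - 5 / 2 * eps) * X + L * (3 / 2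
   + eps / 2)]. As [X >= C], the error costs at most [3 / 2 * eps * X], which leaves
   [K < (1 / 2 - eps) * X]. *)
have : (1 + eps) * (5 / 2 * X - L / 2 + K) < L + 3 * X.
  apply: le_lt_trans (lt_le_trans gain MX).
  by rewrite ler_pM2l; lra.
have : 0 <= eps * K by rewrite mulr_ge0// ltW.
have : delta * X <= eps * X by rewrite ler_wpM2r.
lra.
Qed.

Lemma gain_finite_Hall S : S `<=` solutions ->
  gain_finite R S -> Hall_finite R S.
Proof.
move=> Ssol G delta /andP[d0 d12].
(* With this choice [(1 + eps) * (3 - delta) = 3 - delta / 2 - eps * delta], so half of the saving
   [delta] survives. *)
pose eps := delta / 6.
have eps0 : 0 < eps by rewrite /eps; lra.
pose L := lnz 2.
(* From here on [delta / 2 * log x] exceeds the error [(1 + eps) * L / 2]; the [+ 1] makes this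
   strict. *)
pose C := ((1 + eps) * L + 1) / delta.
have := conj (G _ eps0) (finite_small_solutions C).
rewrite -finite_setU; apply: sub_finite_set => s [Ss].
have sol := Ssol _ Ss; have [E x1 y1 k0] := sol.
have k1 : 1 <= `|tk s| by lia.
rewrite lt_powR_lnE// => Kx.
have X0 := lnz_ge0 x1.
(* The exponent [1 / 2 - delta] is below 1. Hence [|k| < x <= x ^+ 3], which gives
   [y ^+ 2 <= 2 * x ^+ 3]. *)
have kx : `|tk s| < tx s.
  rewrite ltNge; apply/negP => /(ler_lnz x1); nra.
have xx3 : tx s <= tx s ^+ 3 by rewrite ler_eXnr.
have yx : ty s ^+ 2 <= 2 * tx s ^+ 3 by rewrite E; lia.
have [xC|Cx] := ltP (lnz (tx s)) C; [by right|left; split=> //=].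
rewrite gain_gtE//.
have x3 : 1 <= tx s ^+ 3 by exact: exprn_ege1.
have y2 : 1 <= ty s ^+ 2 by exact: exprn_ege1.
have lnM : 3 * lnz (tx s) <= lnz (solM s).
  by rewrite -(lnzX 3)//; apply: ler_lnz; rewrite // /solM le_max lexx.
have lny : 2 * lnz (ty s) <= L + 3 * lnz (tx s).
  by rewrite -(lnzX 3)// -(lnzX 2)// -lnzM//; apply: ler_lnz.
apply: lt_le_trans lnM; rewrite ln_solP//.
move: Cx; rewrite /C ler_pdivrMr//.
move: (lnz (tx s)) (lnz (ty s)) (lnz `|tk s|) X0 lny Kx => X Y K X0 YX KX CX.
apply: (@le_lt_trans _ _ ((1 + eps) * ((3 - delta) * X + L / 2))).
  by rewrite ler_pM2l; lra.
have : 0 <= eps * delta * X by rewrite !mulr_ge0// ltW.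
rewrite /eps in CX *; lra.
Qed.

End Logarithms.

(** The two sides differ in the range of [delta]. For [delta >= 1 / 2] the exponent is at most 0, so
    the power of [x] is at most 1, hence at most [|k|], and the set is empty. *)
Lemma weak_HallE (R : realType) : weak_Hall R <-> Hall_finite R solutions.
Proof.
split=> H delta.
- move=> /andP[d0 _]; apply: sub_finite_set (H _ d0).
  by move=> s [[E x1 y1 k0] lt]; split; rewrite ?normr_gt0.
- move=> d0; have [d12|d12] := ltP delta (1 / 2).
    have := H delta; rewrite d0 d12 => /(_ isT); apply: sub_finite_set.
    by move=> s [E x1 y1 k0 lt]; split=> //; split=> //; rewrite -normr_gt0.
  apply: sub_finite_set (finite_set0 _) => s [_ x1 _ k0].
  have k1 : 1 <= `|tk s| by lia.
  rewrite lt_powR_lnE// => lt.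
  have := ln_ge0 (_ : 1 <= (`|tk s|%:~R : R)); rewrite ler1z => /(_ k1).
  have := ln_ge0 (_ : 1 <= ((tx s)%:~R : R)); rewrite ler1z => /(_ x1).
  by nra.
Qed.

Theorem theorem3p1 (R : realType) :
  (forall S : set triple, S `<=` solutions ->
     (Hall_finite R S <-> gain_finite R S)) /\
  (weak_Hall R <-> gain_finite R solutions).
Proof.
have Hall_gain S : S `<=` solutions -> Hall_finite R S <-> gain_finite R S.
  by split; [exact: Hall_finite_gain|exact: gain_finite_Hall].
by split=> //; rewrite weak_HallE; exact: Hall_gain.
Qed.
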